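(* There exists a strongly regular graph with parameters $(144,52,16,20)$, and there exists a strongly regular graph with parameters $(147,66,25,33)$.
   Context: A finite simple graph on $n$ vertices is strongly regular with parameters $(n,k,\lambda,\mu)$ if every vertex has degree $k$, every pair of distinct adjacent vertices has exactly $\lambda$ common neighbors, and every pair of distinct non-adjacent vertices has exactly $\mu$ common neighbors. *)

(* Defs.v *)
From mathcomp Require Import all_boot.
Set Implicit Arguments. Unset Strict Implicit. Unset Printing Implicit Defensive.

Definition simple_graph (T : finType) (e : rel T) : Prop :=
  irreflexive e /\ symmetric e.

Definition srg (T : finType) (e : rel T) (n k lam mu : nat) : Prop :=
  [/\ simple_graph e,
      #|T| = n,
      forall x : T, #|[set y | e x y]| = k,
      forall x y : T, x != y -> e x y -> #|[set z | e x z && e y z]| = lam &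
      forall x y : T, x != y -> ~~ e x y -> #|[set z | e x z && e y z]| = mu].

(* Main.v *)
Require Import Defs.
From mathcomp Require Import all_boot.

(** Both graphs are Cayley graphs of nonabelian groups, (A_4 x Z_3) : Z_4 for
    144 vertices and Z_7^2 : Z_3 with Z_3 acting by scalars for 147 vertices.
    Their connection sets are partial difference sets found by simulated annealing
    over the inverse-closed subsets of the group; given these sets, strong
    regularity is a finite computation on the adjacency matrix. *)

Definition inner (r s : bitseq) : nat := count (fun p => p.1 && p.2) (zip r s).

(** Cardinals of finite sets are locked against evaluation; on bit lists [vm_compute] can decide
    every clause of [srg]. *)
Definition srg_mx (M : seq bitseq) (n k lam mu : nat) : bool :=
  [&& size M == n,
      all (fun r => size r == n) M,
      all (fun i => ~~ nth false (nth [::] M i) i) (iota 0 n),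
      all (fun i => all (fun j => nth false (nth [::] M i) j ==
                                  nth false (nth [::] M j) i) (iota 0 n))
          (iota 0 n),
      all (fun r => count id r == k) M &
      all (fun i => let r := nth [::] M i in
             all (fun j => (i == j) ||
                    (inner r (nth [::] M j) == if nth false r j then lam else mu))
                 (iota 0 n))
          (iota 0 n)].

Lemma card_count_nth (n : nat) (r : bitseq) :
  size r = n -> #|[set z : 'I_n | nth false r z]| = count id r.
Proof.
move=> rn; rewrite -sum1_card.
rewrite (eq_bigl (fun z : 'I_n => nth false r z)); last by move=> z; rewrite inE.
rewrite -(big_mkord (fun z => nth false r z) (fun=> 1)) sum1_count /index_iota subn0.
by rewrite -[r in RHS](mkseq_nth false) rn count_map.
Qed.

Lemma card_inner (n : nat) (r s : bitseq) :
  size r = n -> size s = n ->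
  #|[set z : 'I_n | nth false r z && nth false s z]| = inner r s.
Proof.
move=> rn sn; pose t := [seq p.1 && p.2 | p <- zip r s].
have zn : size (zip r s) = n by rewrite size_zip rn sn minnn.
have -> : inner r s = count id t by rewrite count_map.
rewrite -(@card_count_nth n) ?size_map //; apply: eq_card => z; rewrite !inE.
by rewrite (nth_map (false, false)) ?zn // nth_zip ?rn ?sn.
Qed.

Lemma srg_mxP (M : seq bitseq) (n k lam mu : nat) :
  srg_mx M n k lam mu ->
  srg (fun x y : 'I_n => nth false (nth [::] M x) y) n k lam mu.
Proof.
case/and5P=> /eqP sM /allP rM /allP irrM /allP symM /andP[/allP degM /allP cnM].
have io (x : 'I_n) : val x \in iota 0 n by rewrite mem_iota /=.
have memM (x : 'I_n) : nth [::] M x \in M by rewrite mem_nth ?sM.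
have szM x := eqP (rM _ (memM x)).
have cn (x y : 'I_n) : x != y ->
    #|[set z : 'I_n | nth false (nth [::] M x) z && nth false (nth [::] M y) z]|
      = if nth false (nth [::] M x) y then lam else mu.
  move=> xy; rewrite card_inner ?szM //.
  move: (allP (cnM _ (io x)) _ (io y)) => /orP[/eqP /val_inj xy_eq | /eqP //].
  by rewrite xy_eq eqxx in xy.
split.
- split=> [x | x y]; first by apply/negbTE/irrM/io.
  exact/eqP/(allP (symM _ (io x)))/io.
- exact: card_ord.
- by move=> x; rewrite card_count_nth ?szM //; apply/eqP/degM/memM.
- by move=> x y xy adj; rewrite cn // adj.
- by move=> x y xy nadj; rewrite cn // (negbTE nadj).
Qed.

(** Binding [N] outside the inner list computes each neighbourhood once per row. *)
Definition cayley_mx (G : eqType) (mul : G -> G -> G) (els D : seq G) :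
    seq bitseq :=
  [seq (let N := [seq mul g d | d <- D] in [seq h \in N | h <- els]) | g <- els].

(** [F_4] has basis [1, w] over [F_2], so [(p, q)] stands for [p + q w].  The
    element [(v, a, b, c)] of [((F_4 : Z_3) x Z_3) : Z_4] acts on [F_4] by
    [x |-> v + w^a frob^c x]; the generator of [Z_4] inverts both copies of
    [Z_3], the second of which acts trivially on [F_4]. *)
Definition G144 : eqType := (bool * bool * nat * nat * nat)%type.

Definition omega (v : bool * bool) : bool * bool := (v.2, v.1 (+) v.2).
Definition frob (v : bool * bool) : bool * bool := (v.1 (+) v.2, v.2).

(** At [m = 0] the inverse [3 - m] is 3, which the outer [%% 3] brings back to 0. *)
Definition mul144 (g h : G144) : G144 :=
  let: (v, a, b, c) := g in let: (v', a', b', c') := h in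
  let u := iter a omega (iter c frob v') in
  let inv_if m := if odd c then 3 - m else m in
  ((v.1 (+) u.1, v.2 (+) u.2), (a + inv_if a') %% 3, (b + inv_if b') %% 3,
   (c + c') %% 4).

Definition F4 : seq (bool * bool) :=
  [:: (false, false); (true, false); (false, true); (true, true)].

Definition els144 : seq G144 :=
  [seq (z, c) | z <- [seq (y, b) | y <- [seq (v, a) | v <- F4, a <- iota 0 3],
                                   b <- iota 0 3], c <- iota 0 4].

(** The lists of those [c] with [(v, a, b, c)] in the connection set: one line for
    each [v], one block for each [a], one entry for each [b]. *)
Definition fibers144 : seq (seq (seq (seq nat))) :=
  [:: [:: [:: [:: 1; 2; 3]; [:: 0; 1; 3]; [:: 0]];
          [:: [:: 2]; [::]; [:: 1; 3]];
          [:: [:: 1; 2; 3]; [:: 1; 3]; [::]]];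
      [:: [:: [:: 2]; [:: 0]; [:: 0]];
          [:: [:: 0; 3]; [:: 1; 2]; [:: 0]];
          [:: [:: 3]; [:: 2]; [:: 3]]];
      [:: [:: [:: 2; 3]; [:: 0; 3]; [:: 0]];
          [:: [:: 1]; [:: 3]; [:: 2]];
          [:: [::]; [:: 0; 2]; [:: 0]]];
      [:: [:: [:: 1; 2]; [:: 0; 1]; [:: 0]];
          [:: [::]; [:: 0; 1; 3]; [:: 0; 2]];
          [:: [:: 0; 1]; [:: 0]; [:: 1; 2]]]].

Definition D144 : seq G144 :=
  [seq g : G144 <- els144 | let: (v, a, b, c) := g in
     c \in nth [::] (nth [::] (nth [::] fibers144 (index v F4)) a) b].

(** [(i, x, y)] is the affine map [u |-> 2^i u + (x, y)] of [F_7^2]. *)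
Definition G147 : eqType := (nat * nat * nat)%type.

(** Since 2 has order 3 modulo 7, the exponents add modulo 3. *)
Definition mul147 (g h : G147) : G147 :=
  let: (i, x, y) := g in let: (j, x', y') := h in
  ((i + j) %% 3, (x + 2 ^ i * x') %% 7, (y + 2 ^ i * y') %% 7).

Definition els147 : seq G147 :=
  [seq (z, y) | z <- [seq (i, x) | i <- iota 0 3, x <- iota 0 7], y <- iota 0 7].

(** The lists of those [y] with [(i, x, y)] in the connection set: one block for
    each [i], one line for each [x].  Character theory forces the translations in
    the connection set ([i = 0]) to be two full lines through the origin, here
    the axes, and a pair [u, -u] on each of the other six lines. *)
Definition fibers147 : seq (seq (seq nat)) :=
  [:: [:: [:: 1; 2; 3; 4; 5; 6];
          [:: 0; 1; 6];
          [:: 0; 3; 4];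
          [:: 0; 2; 5];
          [:: 0; 2; 5];
          [:: 0; 3; 4];
          [:: 0; 1; 6]];
      [:: [:: 0; 2; 3];
          [:: 4; 5; 6];
          [:: 1; 4; 5];
          [:: 2; 3; 6];
          [:: 1; 4; 6];
          [:: 0; 1; 2];
          [:: 0; 3; 5]];
      [:: [:: 0; 2; 6];
          [:: 0; 3; 6];
          [:: 2; 4; 6];
          [:: 1; 4; 5];
          [:: 0; 1; 2];
          [:: 3; 4; 5];
          [:: 1; 3; 5]]].

Definition D147 : seq G147 :=
  [seq g : G147 <- els147 | let: (i, x, y) := g in
     y \in nth [::] (nth [::] fibers147 i) x].

Lemma srg_mx144 : srg_mx (cayley_mx G144 mul144 els144 D144) 144 52 16 20.
Proof. by vm_compute. Qed.

Lemma srg_mx147 : srg_mx (cayley_mx G147 mul147 els147 D147) 147 66 25 33.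
Proof. by vm_compute. Qed.

Theorem theorem1 :
  (exists e : rel 'I_144, srg e 144 52 16 20) /\
  (exists e : rel 'I_147, srg e 147 66 25 33).
Proof.
split; eexists.
- exact: srg_mxP srg_mx144.
- exact: srg_mxP srg_mx147.
Qed.
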